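(* Let $F:\Omega_1\times\Omega_2\to\mathbb{R}$ and $\vec q^{\,*}:\Omega_1\to\Omega_2$ be as in the context, and fix $\vec p\in\Omega_1$. Let $H\in\mathbb{R}^{(M+N)\times(M+N)}$ be the Hessian matrix of $F$ at the point $(\vec p,\vec q^{\,*}(\vec p))$, let $H_{pp}\in\mathbb{R}^{M\times M}$ be its block of second partial derivatives with respect to the $\vec p$ variables, and let $H^*(\delta)\in\mathbb{R}^{M\times M}$ be the approximate shortcut Hessian matrix of $F$ at $\vec p$ with displacement $\delta$. Write $\boldsymbol{\eta}=(\eta_{m,m'})=(H_{pp})^{-1}$ and $\boldsymbol{\eta}(\delta)=(\eta^*_{m,m'}(\delta))=(H^*(\delta))^{-1}$. Suppose that the Hessian matrix $H$ is invertible. Then $H^*(\delta)$ is also invertible for each $\delta>0$, and $$\eta^*_{m,m'}(\delta)\to\eta_{m,m'}\quad\text{as }\delta\to 0$$ for $1\le m\le M$, $1\le m'\le M$. In other words, $H^*(\delta)^{-1}\to H_{pp}^{-1}\big|_{(\vec p,\vec q^{\,*}(\vec p))}$ as $\delta\to 0$.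
   Context: Let $M,N\ge 1$, let $\Omega_1\subseteq\mathbb{R}^M$ and $\Omega_2\subseteq\mathbb{R}^N$ be regions, and let $F:\Omega_1\times\Omega_2\to\mathbb{R}$, $(\vec p,\vec q)\mapsto F(\vec p,\vec q)$, be a smooth function. Standing assumptions: for every $\vec p\in\Omega_1$ the function $F(\vec p,\cdot)$ has a unique minimizer in $\Omega_2$, denoted $\vec q^{\,*}(\vec p)$, so that $F(\vec p,\vec q^{\,*}(\vec p))=\min_{\vec q\in\Omega_2}F(\vec p,\vec q)$, and it is characterized by $\nabla_qF(\vec p,\vec q^{\,*}(\vec p))=0$; the Jacobian matrix of $\vec q\mapsto\nabla_qF(\vec p,\vec q)$, i.e. the $N\times N$ matrix $\left(\partial^2F/\partial q_n\partial q_{n'}\right)$, is nonsingular at $(\vec p,\vec q^{\,*}(\vec p))$, so that $\vec q^{\,*}:\Omega_1\to\mathbb{R}^N$ is smooth. The coordinates of $\mathbb{R}^{M+N}$ are ordered as $(p_1,\dots,p_M,q_1,\dots,q_N)$, so the Hessian matrix $H$ of $F$ has the block form $H=\begin{pmatrix}H_{pp}&H_{pq}\\H_{qp}&H_{qq}\end{pmatrix}$ with $H_{pp}\in\mathbb{R}^{M\times M}$, $H_{pq}\in\mathbb{R}^{M\times N}$, $H_{qp}\in\mathbb{R}^{N\times M}$, $H_{qq}\in\mathbb{R}^{N\times N}$. Let $F^*(\vec p)=F(\vec p,\vec q^{\,*}(\vec p))$ be the reduced function and let $\vec e_m$ be the $m$-th canonical basis vector of $\mathbb{R}^M$. For a displacement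 $\delta>0$ (the points involved being understood to lie in $\Omega_1$), the approximate shortcut Hessian matrix $H^*(\delta)$ at $\vec p$ is the $M\times M$ matrix with entries $$H^*(\delta)_{m,m'}=\frac{1}{4\delta^2}\Big(F^*(\vec p+\delta\vec e_m+\delta\vec e_{m'})-F^*(\vec p-\delta\vec e_m+\delta\vec e_{m'})-F^*(\vec p+\delta\vec e_m-\delta\vec e_{m'})+F^*(\vec p-\delta\vec e_m-\delta\vec e_{m'})\Big).$$
   Formalization: The limit of H*(δ)^{-1} is proved to be the pp block of the inverse Hessian H^{-1} (inverse Schur complement), not (H_pp)^{-1}, and H*(δ) is shown invertible for all sufficiently small δ>0, not for each δ>0; both original claims are false in general. *)

(* Defs.v *)
From mathcomp Require Import all_boot all_order all_algebra.
From mathcomp Require Import all_classical all_reals all_analysis.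

Set Implicit Arguments.
Unset Strict Implicit.
Unset Printing Implicit Defensive.

Import Order.TTheory GRing.Theory Num.Theory.
Import numFieldNormedType.Exports.

Local Open Scope classical_set_scope.
Local Open Scope ring_scope.

Section Smooth.
Context {R : realType} {n : nat}.
Implicit Types (f : 'rV[R]_n -> R) (x : 'rV[R]_n) (U : set 'rV[R]_n).

(* In MathComp-Analysis the empty set is open and connected. *)
Definition region U := [/\ open U, connected U & U !=set0].

Definition ebase (i : 'I_n) : 'rV[R]_n := delta_mx 0 i.

Definition partial (i : 'I_n) f : 'rV[R]_n -> R := fun x => 'D_(ebase i) f x.

Definition iter_partial (s : seq 'I_n) f : 'rV[R]_n -> R := foldr partial f s.

(* C^infinity on an open set U.  The operator 'D is total, so the existence of
   each partial derivative is required separately; the values of f outside U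
   are irrelevant. *)
Definition smooth_on U f := forall (s : seq 'I_n) x, U x ->
  {for x, continuous (iter_partial s f)} /\
  forall i, derivable (iter_partial s f) x (ebase i).

Definition hessian f x : 'M[R]_n := \matrix_(i, j) partial i (partial j f) x.

End Smooth.

Section Reduction.
Context {R : realType} {M N : nat}.
Implicit Types (F : 'rV[R]_(M + N) -> R) (p : 'rV[R]_M) (q : 'rV[R]_N).
Implicit Types qstar : 'rV[R]_M -> 'rV[R]_N.

(* A function of (p, q) is a function of row_mx p q, so that the coordinates
   are ordered as (p_1, ..., p_M, q_1, ..., q_N). *)
Definition prod_domain (O1 : set 'rV[R]_M) (O2 : set 'rV[R]_N)
    : set 'rV[R]_(M + N) :=
  [set x | O1 (lsubmx x) /\ O2 (rsubmx x)].

Definition grad_q F p q : 'rV[R]_N :=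
  \row_(j < N) partial (rshift M j) F (row_mx p q).

Definition minimizer (O2 : set 'rV[R]_N) F p q :=
  O2 q /\ forall q', O2 q' -> F (row_mx p q) <= F (row_mx p q').

Definition reduced F qstar p : R := F (row_mx p (qstar p)).

(* The pp block of the inverse Hessian, (H^-1)_pp, and not the inverse of the
   block H_pp.  By block inversion it is the inverse of the Schur complement
   H_pp - H_pq H_qq^-1 H_qp, whereas the inverse of H_pp is in general not the
   limit of the inverse shortcut Hessians: for F = p^2 + p q + q^2 these are
   constantly 2/3 = (H^-1)_pp, while 1 / H_pp = 1/2. *)
Definition inv_hessian_pp F p q : 'M[R]_M :=
  ulsubmx (invmx (hessian F (row_mx p q))).

End Reduction.

Definition shortcut_hessian {R : realType} {M : nat} (G : 'rV[R]_M -> R)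
    (p : 'rV[R]_M) (d : R) : 'M[R]_M :=
  \matrix_(m, m') ((4 * d ^+ 2)^-1 *
    (G (p + d *: ebase m + d *: ebase m')
     - G (p - d *: ebase m + d *: ebase m')
     - G (p + d *: ebase m - d *: ebase m')
     + G (p - d *: ebase m - d *: ebase m'))).

(* Main.v *)
Require Import Defs.
From mathcomp Require Import all_boot all_order all_algebra.
From mathcomp Require Import all_classical all_reals all_analysis.
From mathcomp Require Import ring lra.
Import Order.TTheory GRing.Theory Num.Theory.
Import numFieldNormedType.Exports.
Local Open Scope classical_set_scope.
Local Open Scope ring_scope.

(** The reduced function F*(p) = min_q F(p, q) has at p a second-order
    expansion whose quadratic part is the Schur complement
    S = H_pp - H_pq H_qq^-1 H_qp (reduced_second_order).  In the central second
    differences that define H*(d), the constant and linear terms cancel and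
    the quadratic term gives S, so the entries of H*(d) tend to those of S
    (shortcut_hessian_cvg).  Since H and H_qq are invertible, S is invertible
    and S^-1 is the pp block of H^-1 (invmx_schur); by Cramer's rule H*(d) is
    then invertible for small d and its inverse converges (cvg_invmx_coord).

    The expansion of F* comes from comparing two values of F(p + h, .) rather
    than from differentiating the minimizer q*.  Writing A = H_qq
    and L h = - A^-1 H_qp h, completing the square gives
    Q(h, k) = S(h, h) + A(k - L h, k - L h) for the quadratic form Q of H
    (complete_square), and A is positive definite, being invertible and
    the Hessian of F(p, .) at a minimum.  Evaluating F(p + h, .) at q* + L h
    bounds F*(p + h) from above by the expected expansion; the exact minimizer
    q* + k bounds it from below, since the square is nonnegative.  The lower
    bound requires the remainder at k to be o(|h|^2), that is, k = O(|h|).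
    This is minimizer_lipschitz: F(p + h, .) has a local minimum in the
    ball of radius K |h| around q*(p), and a critical point is the minimizer.

    The expansion of F itself (smooth_second_order) is obtained from continuous
    second partial derivatives by the mean value theorem along coordinate
    directions, after Schwarz's theorem (partialC). *)

(** * Bilinear forms and Schur complements *)

Section BilinearForms.
Context {R : realType}.

Definition bform {m n} (A : 'M[R]_(m, n)) (u : 'rV[R]_m) (v : 'rV[R]_n) : R :=
  (u *m A *m v^T) 0 0.

Lemma bformDl m n (A : 'M[R]_(m, n)) u1 u2 v :
  bform A (u1 + u2) v = bform A u1 v + bform A u2 v.
Proof. by rewrite /bform !mulmxDl mxE. Qed.

Lemma bformZl m n (A : 'M[R]_(m, n)) t u v :
  bform A (t *: u) v = t * bform A u v.
Proof. by rewrite /bform -!scalemxAl mxE. Qed.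

Lemma bformDr m n (A : 'M[R]_(m, n)) u v1 v2 :
  bform A u (v1 + v2) = bform A u v1 + bform A u v2.
Proof. by rewrite /bform linearD mulmxDr mxE. Qed.

Lemma bformZr m n (A : 'M[R]_(m, n)) t u v :
  bform A u (t *: v) = t * bform A u v.
Proof. by rewrite /bform linearZ -scalemxAr mxE. Qed.

Lemma bform0l m n (A : 'M[R]_(m, n)) v : bform A 0 v = 0.
Proof. by rewrite /bform !mul0mx mxE. Qed.

Lemma bform0r m n (A : 'M[R]_(m, n)) u : bform A u 0 = 0.
Proof. by rewrite /bform trmx0 mulmx0 mxE. Qed.

Lemma bform_tr m n (A : 'M[R]_(m, n)) u v : bform A^T v u = bform A u v.
Proof.
transitivity ((u *m A *m v^T)^T 0 0); last by rewrite mxE.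
by rewrite !trmx_mul trmxK mulmxA.
Qed.

Lemma bform_delta m n (A : 'M[R]_(m, n)) u j :
  bform A u (delta_mx 0 j) = (u *m A) 0 j.
Proof. by rewrite /bform trmx_delta -colE mxE. Qed.

Lemma bformBm m n (A B : 'M[R]_(m, n)) u v :
  bform (A - B) u v = bform A u v - bform B u v.
Proof. by rewrite /bform mulmxBr mulmxBl mxE [X in _ + X]mxE. Qed.

Lemma bform_delta2 m n (A : 'M[R]_(m, n)) i j :
  bform A (delta_mx 0 i) (delta_mx 0 j) = A i j.
Proof. by rewrite bform_delta -rowE mxE. Qed.

Lemma bformC n (A : 'M[R]_n) u v : A^T = A -> bform A u v = bform A v u.
Proof. by move=> AT; rewrite -bform_tr AT. Qed.

Lemma qformD n (A : 'M[R]_n) u v : A^T = A ->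
  bform A (u + v) (u + v) = bform A u u + 2 * bform A u v + bform A v v.
Proof. move=> AT; rewrite bformDl !bformDr (bformC _ _ v u AT); ring. Qed.

(** The discriminant of the nonnegative quadratic t |-> A(u + t v, u + t v).
    As A is only semidefinite, A(v, v) may vanish; the quadratic is then
    affine and bounded below, hence constant. *)
Lemma cauchy_schwarz_form n (A : 'M[R]_n) u v : A^T = A ->
  (forall w, 0 <= bform A w w) ->
  bform A u v ^+ 2 <= bform A u u * bform A v v.
Proof.
move=> AT A0.
set a := bform A u u; set b := bform A u v; set c := bform A v v.
have P t : 0 <= a + 2 * (t * b) + t * (t * c).
  have := A0 (u + t *: v).
  by rewrite qformD// !(bformZl, bformZr).
have c0 : 0 <= c by exact: A0.
have [c_eq0|cN0] := eqVneq c 0.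
  have [->|bN0] := eqVneq b 0; first by rewrite c_eq0 mulr0 expr0n.
  (* At this t the affine function a + 2 t b takes the value -1. *)
  have := P (- (a + 1) / (2 * b)); rewrite c_eq0.
  have -> : a + 2 * (- (a + 1) / (2 * b) * b)
    + - (a + 1) / (2 * b) * (- (a + 1) / (2 * b) * 0) = -1 by field.
  by rewrite ler0N1.
have c_gt0 : 0 < c by rewrite lt_neqAle eq_sym cN0.
(* The minimum of the quadratic is attained at t = - b / c. *)
have := P (- b / c).
have -> : a + 2 * (- b / c * b) + - b / c * (- b / c * c) =
  (a * c - b ^+ 2) / c by field.
by rewrite pmulr_lge0 ?invr_gt0// subr_ge0.
Qed.

Definition schur {m n} (B : 'M[R]_(m + n)) : 'M[R]_m :=
  ulsubmx B - ursubmx B *m invmx (drsubmx B) *m dlsubmx B.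

(** The critical point of k |-> B((h, k), (h, k)); it is the first-order
    response of the minimizer to a displacement h of the parameters. *)
Definition schur_min {m n} (B : 'M[R]_(m + n)) (h : 'rV[R]_m) : 'rV[R]_n :=
  - (h *m ursubmx B *m invmx (drsubmx B)).

Lemma bform_row_mx m n (B : 'M[R]_(m + n)) h k : B^T = B ->
  bform B (row_mx h k) (row_mx h k) =
  bform (ulsubmx B) h h + 2 * bform (ursubmx B) h k + bform (drsubmx B) k k.
Proof.
have addE (X Y : 'M[R]_1) : (X + Y) 0 0 = X 0 0 + Y 0 0 by rewrite mxE.
move=> BT; rewrite /bform -[in LHS](submxK B) mul_row_block tr_row_mx.
rewrite mul_row_col !mulmxDl !addE.
have -> : (k *m dlsubmx B *m h^T) 0 0 = (h *m ursubmx B *m k^T) 0 0.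
  by rewrite -[LHS]/(bform _ _ _) -bform_tr trmx_dlsub BT.
ring.
Qed.

(** Partial minimization of a quadratic form: when the qq block is
    positive, this identity shows that minimizing over k leaves the Schur
    complement as a form in h, the minimum being reached at schur_min B h. *)
Lemma complete_square m n (B : 'M[R]_(m + n)) h k :
  B^T = B -> drsubmx B \in unitmx ->
  bform B (row_mx h k) (row_mx h k) = bform (schur B) h h +
    bform (drsubmx B) (k - schur_min B h) (k - schur_min B h).
Proof.
move=> BT Au; rewrite bform_row_mx// /schur_min opprK.
set A := drsubmx B in Au *; set C := ursubmx B.
have AT : A^T = A by rewrite trmx_drsub BT.
rewrite [in RHS]qformD//.
have crossE : bform A k (h *m C *m invmx A) = bform C h k.
  rewrite bformC// /bform; congr (_ 0 0).
  by rewrite mulmxKV.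
have sqE : bform A (h *m C *m invmx A) (h *m C *m invmx A) =
    bform (C *m invmx A *m dlsubmx B) h h.
  rewrite /bform; congr (_ 0 0).
  rewrite !trmx_mul trmx_inv AT /C trmx_ursub BT.
  by rewrite -!mulmxA mulKmx // !mulmxA.
rewrite crossE sqE /schur -/A -/C.
rewrite bformBm; ring.
Qed.

Lemma schur_sym m n (B : 'M[R]_(m + n)) : B^T = B -> (schur B)^T = schur B.
Proof.
move=> BT; rewrite /schur linearB /= !trmx_mul trmx_inv.
by rewrite trmx_ulsub trmx_ursub trmx_dlsub trmx_drsub BT mulmxA.
Qed.

(** The first block column (X, Z) of the inverse solves
    B_pp X + B_pq Z = 1 and B_qp X + B_qq Z = 0; eliminating Z from the second
    equation turns the first into (schur B) X = 1. *)
Lemma invmx_schur m n (B : 'M[R]_(m + n)) :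
  drsubmx B \in unitmx -> B \in unitmx ->
  schur B \in unitmx /\ ulsubmx (invmx B) = invmx (schur B).
Proof.
move=> Au Bu.
have := mulmxV Bu; rewrite -{1}(submxK B) -{1}(submxK (invmx B)) mulmx_block.
rewrite (@scalar_mx_block _ m n) => /eq_block_mx.
set X := ulsubmx (invmx B); set Z := dlsubmx (invmx B).
case=> E1 _ E2 _.
have ZE : Z = - (invmx (drsubmx B) *m (dlsubmx B *m X)).
  rewrite -mulmxN; apply: (canRL (mulKmx Au)).
  by apply/eqP; rewrite -addr_eq0 addrC E2.
have SX : schur B *m X = 1%:M.
  by rewrite -E1 ZE /schur mulmxBl mulmxN !mulmxA.
have [Su _] := mulmx1_unit SX.
by split => //; rewrite -[X](mulKmx Su) SX mulmx1.
Qed.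

End BilinearForms.

(** * Norm estimates and continuity of the inverse *)

Section Estimates.
Context {R : realType}.

Lemma rV_norm_leP n (v : 'rV[R]_n) c : 0 <= c ->
  `|v| <= c <-> forall i, `|v 0 i| <= c.
Proof.
move=> c0; rewrite [X in X <= _]/Num.Def.normr /= mx_normrE; split.
  by move=> /bigmax_leP[_ H] i; exact: (H (0, i)).
by move=> H; apply/bigmax_leP; split => // -[i j] _ /=; rewrite ord1.
Qed.

Lemma rV_coord_le n (v : 'rV[R]_n) i : `|v 0 i| <= `|v|.
Proof. by move: i; apply/rV_norm_leP. Qed.

Lemma row_mx_norm_le m n (h : 'rV[R]_m) (k : 'rV[R]_n) c :
  `|h| <= c -> `|k| <= c -> `|row_mx h k| <= c.
Proof.
move=> hc kc; have c0 : 0 <= c by exact: le_trans hc.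
apply/rV_norm_leP => // i; rewrite mxE; case: splitP => j _.
  exact: le_trans (rV_coord_le _ _ _) hc.
exact: le_trans (rV_coord_le _ _ _) kc.
Qed.

Lemma ebase_norm n (i : 'I_n) : `|ebase i : 'rV[R]_n| <= 1.
Proof.
apply/rV_norm_leP => // j.
by rewrite mxE; case: (_ && _); rewrite ?normr1 ?normr0.
Qed.

Lemma mulmx_bounded m n (A : 'M[R]_(m, n)) :
  exists2 C, 0 < C & forall u : 'rV[R]_m, `|u *m A| <= C * `|u|.
Proof.
pose C := 1 + \sum_i \sum_j `|A i j|.
have C0 : 0 < C by rewrite ltr_pwDl// sumr_ge0 // => i _; rewrite sumr_ge0.
exists C => // u; apply/rV_norm_leP => [|j]; first by rewrite mulr_ge0// ltW.
rewrite mxE (le_trans (ler_norm_sum _ _ _))//.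
rewrite /C mulrDl mul1r ler_wpDl// mulr_suml ler_sum// => i _.
rewrite normrM mulrC ler_pM ?rV_coord_le//.
by rewrite (bigD1 j)//= lerDl sumr_ge0.
Qed.

Lemma bform_bounded m n (A : 'M[R]_(m, n)) :
  exists2 C, 0 < C & forall u v, `|bform A u v| <= C * `|u| * `|v|.
Proof.
have [C C0 HC] := mulmx_bounded _ _ A.
exists (C * (1 + n%:R)) => [|u v]; first by rewrite mulr_gt0// ltr_pwDl.
rewrite /bform mxE (le_trans (ler_norm_sum _ _ _))//.
apply: (@le_trans _ _ (\sum_(j < n) C * `|u| * `|v|)).
  apply: ler_sum => j _; rewrite normrM [v^T _ _]mxE ler_pM ?rV_coord_le//.
  exact: le_trans (rV_coord_le _ _ _) (HC u).
rewrite sumr_const card_ord -mulr_natr.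
have : 0 <= C * `|u| * `|v| by rewrite !mulr_ge0// ltW.
nra.
Qed.

(** By Cauchy-Schwarz against the rows e_i A^-1, each coordinate satisfies
    k_i^2 = A(e_i A^-1, k)^2 <= (A^-1)_ii A(k, k), so that semidefiniteness
    and invertibility yield an explicit coercivity constant. *)
Lemma coercive_form n (A : 'M[R]_n) : A^T = A -> A \in unitmx ->
  (forall w, 0 <= bform A w w) ->
  exists2 c, 0 < c & forall k, c * `|k| ^+ 2 <= bform A k k.
Proof.
move=> AT Au A0; pose e i := ebase i *m invmx A.
(* The summands are the diagonal entries of A^-1; adding 1 makes C positive. *)
pose C := 1 + \sum_i bform A (e i) (e i).
have C0 : 0 < C by rewrite ltr_pwDl// sumr_ge0.
have C_ge0 := ltW C0; exists C^-1 => [|k]; first by rewrite invr_gt0.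
rewrite mulrC ler_pdivrMr// -(@ler_sqrt _ _ (bform A k k * C)) ?mulr_ge0//.
rewrite sqrtr_sqr normr_id; apply/rV_norm_leP => // i.
rewrite -sqrtr_sqr ler_sqrt ?mulr_ge0//.
have -> : k 0 i = bform A (e i) k.
  by rewrite /bform mulmxKV// -rowE !mxE.
apply: le_trans (cauchy_schwarz_form _ _ _ _ AT A0) _.
rewrite mulrC ler_wpM2l// /C (bigD1 i)//= addrCA lerDl.
by rewrite addr_ge0// sumr_ge0.
Qed.

(** Cramer's rule: the determinant and the cofactors are polynomials in the
    entries, and the limiting determinant is nonzero. *)
Lemma cvg_invmx_coord n (T : Type) (F : set_system T)
    (A : T -> 'M[R]_n) (B : 'M[R]_n) :
  Filter F -> B \in unitmx -> (forall i j, A t i j @[t --> F] --> B i j) ->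
  (\forall t \near F, A t \in unitmx) /\
  forall i j, invmx (A t) i j @[t --> F] --> invmx B i j.
Proof.
move=> FF Bu AB.
have cvg_det m (A' : T -> 'M[R]_m) (B' : 'M[R]_m) :
    (forall i j, A' t i j @[t --> F] --> B' i j) ->
    \det (A' t) @[t --> F] --> \det B'.
  move=> AB'; apply: cvg_big => [|s _]; first exact: add_continuous.
  apply: cvgM; first exact: cvg_cst.
  by apply: cvg_big => [|i _]; [exact: mul_continuous|exact: AB'].
have dAB := cvg_det _ _ _ AB.
have dB0 : \det B != 0 by rewrite -unitfE -unitmxE.
have Au : \forall t \near F, A t \in unitmx.
  have dA0 : \forall t \near F, \det (A t) != 0 by exact: cvgr_neq0 dAB dB0.
  by apply: filterS dA0 => t; rewrite unitmxE unitfE.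
split => // i j.
have : (\det (A t))^-1 * cofactor (A t) j i @[t --> F] -->
    (\det B)^-1 * cofactor B j i.
  apply: cvgM; first exact: cvgV.
  apply: cvgM; first exact: cvg_cst.
  apply: cvg_det => i' j'; under eq_cvg do rewrite !mxE.
  by rewrite !mxE; exact: AB.
rewrite {2}/invmx Bu !mxE; apply: cvg_trans.
apply: near_eq_cvg; apply: filterS Au => t tu.
by rewrite /invmx tu !mxE.
Qed.

End Estimates.

(** * Second-order expansion of a smooth function *)

Section Calculus.
Context {R : realType}.

Lemma is_derive_translate n (f : 'rV[R]_n -> R) c x v d :
  is_derive (c + x) v f d -> is_derive x v (fun y => f (c + y)) d.
Proof.
have E : (fun h : R => h^-1 *: (f (h *: v + (c + x)) - f (c + x))) =
         (fun h : R => h^-1 *: (f (c + (h *: v + x)) - f (c + x))).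
  by apply/funext => h; rewrite (addrCA c).
move=> [D1 D2]; apply: DeriveDef.
  by move: D1; rewrite /derivable /= E.
by move: D2; rewrite /derive /= E.
Qed.

Lemma is_derive_line n (f : 'rV[R]_n -> R) x v (t : R) d :
  is_derive (x + t *: v) v f d -> is_derive t 1 (fun s : R => f (x + s *: v)) d.
Proof.
have E : (fun h : R => h^-1 *: (f (h *: v + (x + t *: v)) - f (x + t *: v))) =
         (fun h : R => h^-1 *: (f (x + (h *: 1 + t) *: v) - f (x + t *: v))).
  by apply/funext => h; rewrite [h *: 1]mulr1 scalerDl addrCA.
move=> [D1 D2]; apply: DeriveDef.
  by move: D1; rewrite /derivable /= E.
by move: D2; rewrite /derive /= E.
Qed.

(** The difference quotient is a + h b for h <> 0.  This gives the
    directional derivatives of linear and quadratic forms at once. *)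
Lemma is_derive_quadratic n (f : 'rV[R]_n -> R) x v a b :
  (forall h : R, f (h *: v + x) = f x + h * a + h ^+ 2 * b) ->
  is_derive x v f a.
Proof.
move=> fE.
have L : h^-1 *: ((f \o shift x) (h *: v) - f x) @[h --> (0:R)^'] --> a.
  have : a + h * b @[h --> (0:R)^'] --> a.
    rewrite -[X in _ --> X]addr0 -[X in _ --> _ + X](mul0r b).
    apply: cvgD; first exact: cvg_cst.
    apply: cvgM; last exact: cvg_cst.
    by apply: cvg_within_filter; exact: cvg_id.
  apply: cvg_trans; apply: near_eq_cvg; near=> h.
  have h0 : h != 0 by near: h; exact: nbhs_dnbhs_neq.
  by rewrite /= fE -[RHS]/(h^-1 * (f x + h * a + h ^+ 2 * b - f x)); field.
by apply: DeriveDef; [apply/cvg_ex; exists a|exact: cvg_lim L].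
Unshelve. all: by end_near. Qed.

Lemma mean_value_line n (f : 'rV[R]_n -> R) x v (a b : R) (df : R -> R) :
  a <= b ->
  (forall s, a <= s <= b -> is_derive (x + s *: v) v f (df s)) ->
  exists2 c, a <= c <= b & f (x + b *: v) - f (x + a *: v) = df c * (b - a).
Proof.
move=> ab fd.
have fd' s : s \in `[a, b]%R ->
    is_derive s 1 (fun s : R => f (x + s *: v)) (df s).
  by rewrite in_itv /= => sab; exact/is_derive_line/fd.
have gC : {within `[a, b], continuous (fun s : R => f (x + s *: v))}.
  apply: derivable_within_continuous => s /fd' ds.
  exact: (@ex_derive _ _ _ _ _ _ _ ds).
have gD s : s \in `]a, b[%R ->
    is_derive s 1 (fun s : R => f (x + s *: v)) (df s).
  by rewrite in_itv/= => /andP[? ?]; apply: fd'; rewrite in_itv/= !ltW.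
have [c cab E] := @MVT_segment R (fun s : R => f (x + s *: v)) df a b ab gD gC.
by exists c => //; move: cab; rewrite in_itv.
Qed.

(** Move from 0 to h one coordinate at a time and apply the mean value
    theorem to each move.  For the sup norm every intermediate point has norm
    at most that of h, so bounds on that ball suffice. *)
Lemma lipschitz_of_partials n (g : 'rV[R]_n -> R) C h : 0 <= C ->
  (forall y i, `|y| <= `|h| ->
     exists2 d, is_derive y (ebase i) g d & `|d| <= C) ->
  `|g h - g 0| <= n%:R * (C * `|h|).
Proof.
move=> C0 gd.
(* The path: keep the first k coordinates of h. *)
pose tr k : 'rV[R]_n := \row_i (if (i < k)%N then h 0 i else 0).
have trN (k : nat) (i : 'I_n) s : k = i -> `|s| <= `|h 0 i| ->
    `|tr k + s *: ebase i| <= `|h|.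
  move=> ki sh; apply/rV_norm_leP => // j; rewrite !mxE eqxx /=.
  have [->|ji] := eqVneq j i.
    by rewrite ki ltnn add0r mulr1 (le_trans sh)// rV_coord_le.
  by rewrite mulr0 addr0; case: ifP => _; rewrite ?rV_coord_le ?normr0.
have step (k : nat) (i : 'I_n) : k = i -> `|g (tr k.+1) - g (tr k)| <= C * `|h|.
  move=> ki.
  have -> : tr k.+1 = tr k + h 0 i *: ebase i.
    apply/rowP => j; rewrite !mxE eqxx /= ltnS ki.
    have [->|ji] := eqVneq j i; first by rewrite leqnn ltnn mulr1 add0r.
    by rewrite mulr0 addr0 leq_eqVlt val_eqE (negPf ji).
  pose df s := 'D_(ebase i) g (tr k + s *: ebase i).
  have D s : `|s| <= `|h 0 i| ->
      is_derive (tr k + s *: ebase i) (ebase i) g (df s) /\ `|df s| <= C.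
    move=> sh; have [d gdd dC] := gd _ i (trN k i s ki sh).
    by rewrite /df derive_val.
  have hiN := rV_coord_le _ h i.
  have [h0|h0] := leP 0 (h 0 i).
    have [s /andP[s0 sh]|c /andP[c0 ch]] :=
      mean_value_line _ g (tr k) (ebase i) _ _ df h0.
      by apply: (D s _).1; rewrite !ger0_norm.
    rewrite scale0r addr0 subr0 => ->; rewrite normrM ler_pM//.
    by apply: (D c _).2; rewrite !ger0_norm.
  have [s /andP[s0 sh]|c /andP[c0 ch]] :=
    mean_value_line _ g (tr k) (ebase i) _ _ df (ltW h0).
    by apply: (D s _).1; rewrite !ler0_norm ?lerN2// ltW.
  rewrite scale0r addr0 sub0r distrC => ->; rewrite normrM normrN ler_pM//.
  by apply: (D c _).2; rewrite !ler0_norm ?lerN2// ltW.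
have tr0 : tr 0 = 0 by apply/rowP => j; rewrite !mxE.
have trn : tr n = h by apply/rowP => j; rewrite !mxE ltn_ord.
suff H k : (k <= n)%N -> `|g (tr k) - g 0| <= k%:R * (C * `|h|).
  by rewrite -[X in g X - _]trn; exact: H.
elim: k => [_|k IH kn]; first by rewrite tr0 subrr normr0 mul0r.
have := ler_normD (g (tr k.+1) - g (tr k)) (g (tr k) - g 0).
have := step k (Ordinal kn) erefl; have := IH (ltnW kn).
rewrite subrKA -natr1 mulrDl mul1r; lra.
Qed.

Lemma near_shiftP n (x : 'rV[R]_n) (P : 'rV[R]_n -> Prop) :
  (\forall y \near x, P y) ->
  exists2 r : R, 0 < r & forall h, `|h| < r -> P (x + h).
Proof.
move=> /nbhs_ballP[r /= r0 H]; exists r => // h hr; apply: H.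
by rewrite -ball_normE /= opprD addNKr normrN.
Qed.

Lemma smooth_is_derive n (U : set 'rV[R]_n) f (s : seq 'I_n) i y :
  smooth_on U f -> U y ->
  is_derive y (ebase i) (iter_partial s f) (iter_partial (i :: s) f y).
Proof. by move=> fU /(fU s)[_ D]; exact/derivableP/D. Qed.

(** Two mean values: first in direction i for y |-> f (y + s e_j) - f y,
    then in direction j for the partial derivative of f in direction i. *)
Lemma second_difference n (U : set 'rV[R]_n) f i j x s :
  smooth_on U f -> 0 <= s ->
  (forall h, `|h| <= 2 * s -> U (x + h)) ->
  exists2 h, `|h| <= 2 * s &
    f (x + s *: ebase i + s *: ebase j) - f (x + s *: ebase i)
      - f (x + s *: ebase j) + f x = s ^+ 2 * iter_partial [:: j; i] f (x + h).
Proof.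
move=> fU s0 xU.
have small a b : 0 <= a <= s -> 0 <= b <= s ->
    `|a *: ebase i + b *: ebase j : 'rV[R]_n| <= 2 * s.
  move=> /andP[a0 as_] /andP[b0 bs].
  rewrite (le_trans (ler_normD _ _))// !normrZ !ger0_norm//.
  have := ler_wpM2l a0 (ebase_norm n i); have := ler_wpM2l b0 (ebase_norm n j).
  lra.
have s_in : 0 <= s <= s by rewrite s0 lexx.
have o_in : (0:R) <= 0 <= s by rewrite s0 lexx.
pose D := iter_partial [:: i] f.
have D1 a b : 0 <= a <= s -> 0 <= b <= s ->
    is_derive (x + a *: ebase i + b *: ebase j) (ebase i) f
      (D (x + a *: ebase i + b *: ebase j)).
  move=> a_in b_in; apply: (smooth_is_derive _ _ _ [::] _ _ fU).
  by rewrite -addrA; apply/xU/small.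
have [t t_in|a a_in Ea] := mean_value_line _
    (fun y => f (s *: ebase j + y) - f y) x (ebase i) 0 s
    (fun t => D (x + t *: ebase i + s *: ebase j) - D (x + t *: ebase i)) s0.
  apply: is_deriveB.
    by apply: is_derive_translate; rewrite addrC; exact: D1.
  by have := D1 t 0 t_in o_in; rewrite scale0r addr0.
have [t t_in|b b_in Eb] := mean_value_line _ D (x + a *: ebase i) (ebase j) 0 s
    (fun t => iter_partial [:: j; i] f (x + a *: ebase i + t *: ebase j)) s0.
  apply: (smooth_is_derive _ _ _ [:: i] _ _ fU).
  by rewrite -addrA; apply/xU/small.
exists (a *: ebase i + b *: ebase j); first exact: small.
move: Ea Eb; rewrite !scale0r !addr0 !subr0 => Ea Eb.
have sE (y : R) : s ^+ 2 * y = y * s * s by ring.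
rewrite sE (addrA x) -Eb -Ea.
by rewrite [s *: _ + (_ + _)]addrC [s *: _ + x]addrC; ring.
Qed.

Lemma iter_partial_near n (U : set 'rV[R]_n) f (s : seq 'I_n) x e :
  smooth_on U f -> U x -> 0 < e ->
  exists2 r, 0 < r &
    forall h, `|h| < r -> `|iter_partial s f (x + h) - iter_partial s f x| <= e.
Proof.
move=> fU /(fU s)[/cvgrPdist_le/(_ _ _)/near_shiftP fc _] e0.
have [r r0 H] := fc _ e0; exists r => // h /H.
by rewrite distrC.
Qed.

Lemma open_ball_sub n (U : set 'rV[R]_n) x : open U -> U x ->
  exists2 r : R, 0 < r & forall h, `|h| < r -> U (x + h).
Proof. by move=> oU xU; apply/near_shiftP/open_nbhs_nbhs. Qed.

(** Schwarz's theorem: the second difference is symmetric in i and j, so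
    by the preceding mean value formula the two mixed derivatives coincide at
    two points that both tend to x with s. *)
Lemma partialC n (U : set 'rV[R]_n) f i j x : open U -> smooth_on U f -> U x ->
  partial i (partial j f) x = partial j (partial i f) x.
Proof.
move=> oU fU xU; apply/eqP; rewrite -subr_eq0 -normr_le0.
apply/ler_addgt0Pl => e e0; rewrite addr0.
have e2 : 0 < e / 2 by rewrite divr_gt0.
have [r r0 rU] := open_ball_sub _ _ _ oU xU.
have [r1 r10 H1] := iter_partial_near _ _ _ [:: i; j] _ _ fU xU e2.
have [r2 r20 H2] := iter_partial_near _ _ _ [:: j; i] _ _ fU xU e2.
pose m := Num.min r (Num.min r1 r2); pose s := m / 4.
have m0 : 0 < m by rewrite !lt_min r0 r10 r20.
have [mr [mr1 mr2]] : m <= r /\ m <= r1 /\ m <= r2.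
  by rewrite !ge_min !lexx !orbT.
have s0 : 0 < s by rewrite divr_gt0.
have sm : 2 * s < m by rewrite /s; lra.
have [|h1 h1s E1] := second_difference _ _ _ j i x s fU (ltW s0).
  by move=> h hs; apply/rU/(le_lt_trans hs)/(lt_le_trans sm).
have [|h2 h2s E2] := second_difference _ _ _ i j x s fU (ltW s0).
  by move=> h hs; apply/rU/(le_lt_trans hs)/(lt_le_trans sm).
have := H1 h1 (le_lt_trans h1s (lt_le_trans sm mr1)).
have := H2 h2 (le_lt_trans h2s (lt_le_trans sm mr2)).
have <- : iter_partial [:: i; j] f (x + h1) = iter_partial [:: j; i] f (x + h2).
  have s2 : s ^+ 2 != 0 by rewrite expf_neq0// gt_eqF.
  apply: (mulfI s2); apply: etrans (esym E1) _; apply: etrans _ E2.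
  by rewrite [x + _ + s *: ebase i]addrAC [X in X + f x]addrAC.
rewrite /= => B1 B2.
set a := partial i _ x in B2 *; set b := partial j _ x in B1 *.
set c := partial i (partial j f) (x + h1) in B1 B2.
have -> : a - b = (c - b) - (c - a) by ring.
apply: le_trans (ler_normB _ _) _; rewrite (splitr e).
by apply: lerD; [exact: B1|exact: B2].
Qed.

Lemma hessian_sym n (U : set 'rV[R]_n) f x : open U -> smooth_on U f -> U x ->
  (hessian f x)^T = hessian f x.
Proof.
by move=> oU fU xU; apply/matrixP => i j; rewrite !mxE (partialC _ U).
Qed.

Lemma uniform_radius n (I : finType) (P : I -> 'rV[R]_n -> Prop) :
  (forall i, exists2 r : R, 0 < r & forall h, `|h| < r -> P i h) ->
  exists2 r : R, 0 < r & forall i h, `|h| < r -> P i h.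
Proof.
move=> H; have : \forall h \near (0 : 'rV[R]_n), forall i, P i h.
  have H' i : \forall h \near (0 : 'rV[R]_n), P i h.
    by apply/nbhs_norm0P; exact: H.
  exact: (filter_forall _ H').
by move=> /nbhs_norm0P[r r0 rP]; exists r => // i h /rP.
Qed.

(** An expansion of order 2 with Peano remainder.  It does not make f twice
    differentiable at x, which is what allows it to be proved directly
    for the reduced function. *)
Definition second_order_at {n} (f : 'rV[R]_n -> R) (x : 'rV[R]_n)
    (g : 'cV[R]_n) (A : 'M[R]_n) :=
  forall e, 0 < e -> exists2 r, 0 < r & forall h, `|h| < r ->
    `|f (x + h) - f x - (h *m g) 0 0 - 2^-1 * bform A h h| <= e * `|h| ^+ 2.

(** The difference G of f and its Taylor polynomial has vanishing second
    derivatives at x, hence small ones near x.  Integrating twice by means of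
    lipschitz_of_partials bounds first the derivatives of G by a small
    multiple of |h|, and then G itself by a small multiple of |h|^2.  The
    symmetry of the Hessian enters in the derivative of the quadratic part. *)
Lemma smooth_second_order n (U : set 'rV[R]_n) f x :
  open U -> smooth_on U f -> U x ->
  second_order_at f x (\col_i partial i f x) (hessian f x).
Proof.
move=> oU fU xU e e0.
set g := \col_i _; set A := hessian f x.
have AT : A^T = A by exact: hessian_sym oU fU xU.
(* Each integration costs a factor n. *)
pose e' := e / (1 + n%:R ^+ 2).
have n1 : 0 < 1 + n%:R ^+ 2 :> R by rewrite ltr_pwDl// exprn_ge0.
have e'0 : 0 < e' by rewrite divr_gt0.
have [r0 r00 rU] := open_ball_sub _ _ _ oU xU.
have [r1 r10 H1] := uniform_radius _ _ _ (fun ij : 'I_n * 'I_n =>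
  iter_partial_near _ _ _ [:: ij.1; ij.2] _ _ fU xU e'0).
exists (Num.min r0 r1) => [|h]; first by rewrite lt_min r00.
rewrite lt_min => /andP[hr0 hr1].
(* D j is the partial derivative of G in direction j. *)
pose D j (y : 'rV[R]_n) :=
  partial j f (x + y) - partial j f x - bform A (ebase j) y.
have DE i j y :
    is_derive y (ebase i) (fun y : 'rV[R]_n => bform A (ebase j) y) (A j i).
  apply: (is_derive_quadratic _ _ _ _ _ 0) => t.
  by rewrite bformDr bformZr /ebase bform_delta2; ring.
have Dd i j y : `|y| <= `|h| ->
    is_derive y (ebase i) (D j) (iter_partial [:: i; j] f (x + y) - A i j).
  move=> yh; have yU : U (x + y) by apply/rU/(le_lt_trans yh).
  have -> : A i j = A j i by rewrite -{1}AT mxE.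
  apply: is_deriveB.
  rewrite -[X in is_derive _ _ _ X]subr0.
  apply: is_deriveB.
  apply: is_derive_translate.
  exact: (smooth_is_derive _ _ _ [:: j] _ _ fU).
have D0 j : D j 0 = 0.
  by rewrite /D addr0 /bform trmx0 mulmx0 mxE; ring.
have DB j y : `|y| <= `|h| -> `|D j y| <= n%:R * (e' * `|h|).
  move=> yh.
  rewrite -[D j y]subr0 -(D0 j).
  apply: le_trans (_ : n%:R * (e' * `|y|) <= _); last first.
    by rewrite ler_wpM2l// ler_wpM2l// ltW.
  apply: lipschitz_of_partials => [|z i zy]; first exact: ltW.
  have zh := le_trans zy yh.
  eexists; first exact: Dd.
  by rewrite /A mxE; exact: (H1 (i, j) z (le_lt_trans zh hr1)).
pose G (y : 'rV[R]_n) := f (x + y) - (y *m g) 0 0 - 2^-1 * bform A y y.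
have gE j (y : 'rV[R]_n) :
    is_derive y (ebase j) (fun y => (y *m g) 0 0) (partial j f x).
  apply: (is_derive_quadratic _ _ _ _ _ 0) => t.
  by rewrite mulmxDl -scalemxAl mxE [X in X + _]mxE -rowE !mxE; ring.
have qE j y :
    is_derive y (ebase j) (fun y => 2^-1 * bform A y y) (bform A (ebase j) y).
  apply: (is_derive_quadratic _ _ _ _ _ (2^-1 * A j j)) => t.
  rewrite qformD// !(bformZl, bformZr) bform_delta2.
  by field.
have Gd j y : `|y| <= `|h| -> is_derive y (ebase j) G (D j y).
  move=> yh; have yU : U (x + y) by apply/rU/(le_lt_trans yh).
  apply: is_deriveB; apply: is_deriveB.
  apply: is_derive_translate.
  exact: (smooth_is_derive _ _ _ [::] _ _ fU).
have -> : f (x + h) - f x - (h *m g) 0 0 - 2^-1 * bform A h h = G h - G 0.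
  have -> : G 0 = f x.
    by rewrite /G addr0 mul0mx /bform trmx0 mulmx0 !mxE mulr0 !subr0.
  by rewrite /G; ring.
apply: (@le_trans _ _ (n%:R * (n%:R * (e' * `|h|) * `|h|))).
  apply: lipschitz_of_partials => [|y j yh].
    by rewrite !mulr_ge0// ltW.
  by exists (D j y); [exact: Gd|exact: DB].
have -> : n%:R * (n%:R * (e' * `|h|) * `|h|) =
    n%:R ^+ 2 / (1 + n%:R ^+ 2) * (e * `|h| ^+ 2).
  by rewrite /e'; field; rewrite gt_eqF.
rewrite ler_piMl ?mulr_ge0 ?exprn_ge0 ?(ltW e0)//.
by rewrite ler_pdivrMr// mul1r lerDr.
Qed.

End Calculus.

(** * Central second differences and interior critical points *)

Section Shortcut.
Context {R : realType}.

(** In the central second difference the constant and linear terms of the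
    expansion cancel and the quadratic term gives S exactly.  The displacements
    have norm at most 2 d, so the four remainders are o(d^2) and survive
    division by 4 d^2. *)
Lemma shortcut_hessian_cvg n (G : 'rV[R]_n -> R) p g S : S^T = S ->
  second_order_at G p g S -> forall m m' : 'I_n,
  (shortcut_hessian G p d m m' : R) @[d --> (0:R)^'+] --> (S m m' : R).
Proof.
move=> ST GS m m'; apply/cvgrPdist_le => e e0.
have e40 : 0 < e / 4 by rewrite divr_gt0.
have [r r0 H] := GS _ e40.
near=> d.
have d0 : 0 < d by near: d; exact: nbhs_right_gt.
have dr : d < r / 2 by near: d; apply: nbhs_right_lt; rewrite divr_gt0.
pose rho w := G (p + w) - G p - (w *m g) 0 0 - 2^-1 * bform S w w.
have rhoB s s' : `|s| = d -> `|s'| = d ->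
    `|rho (s *: ebase m + s' *: ebase m')| <= e * d ^+ 2.
  move=> sd s'd; have wd : `|s *: ebase m + s' *: ebase m' : 'rV[R]_n| <= 2 * d.
    rewrite (le_trans (ler_normD _ _))// !normrZ sd s'd.
    have := ler_wpM2l (ltW d0) (ebase_norm n m).
    have := ler_wpM2l (ltW d0) (ebase_norm n m').
    lra.
  apply: (le_trans (H _ _)); first by apply: le_lt_trans wd _; lra.
  have -> : e * d ^+ 2 = e / 4 * (2 * d) ^+ 2 by field.
  rewrite ler_wpM2l ?(ltW e40)//.
  by rewrite ler_sqr ?nnegrE// mulr_ge0// ltW.
have GE s s' : G (p + s *: ebase m + s' *: ebase m') =
    rho (s *: ebase m + s' *: ebase m') + G p
    + s * g m 0 + s' * g m' 0
    + 2^-1 * (s ^+ 2 * S m m + 2 * (s * (s' * S m m')) + s' ^+ 2 * S m' m').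
  rewrite /rho qformD// !(bformZl, bformZr) /ebase !bform_delta2 addrA.
  have -> : ((s *: (delta_mx 0 m : 'rV[R]_n) + s' *: delta_mx 0 m') *m g) 0 0
      = s * g m 0 + s' * g m' 0.
    by rewrite mulmxDl -!scalemxAl -!rowE !mxE.
  ring.
have dN : `|d| = d by rewrite ger0_norm// ltW.
have dNN : `|- d| = d by rewrite normrN.
have d2 : 0 < 4 * d ^+ 2 by rewrite mulr_gt0// exprn_gt0.
have shE : S m m' - shortcut_hessian G p d m m' =
    (rho (- d *: ebase m + d *: ebase m')
     + rho (d *: ebase m + - d *: ebase m')
     - rho (d *: ebase m + d *: ebase m')
     - rho (- d *: ebase m + - d *: ebase m'))
    / (4 * d ^+ 2).
  rewrite [shortcut_hessian _ _ _ _ _]mxE.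
  rewrite -(scaleNr d (ebase m)) -(scaleNr d (ebase m')) !GE.
  by field; rewrite gt_eqF.
rewrite shE normrM normfV [X in _ / X]ger0_norm ?(ltW d2)// ler_pdivrMr//.
have := rhoB _ _ dN dN; have := rhoB _ _ dNN dNN.
have := rhoB _ _ dN dNN; have := rhoB _ _ dNN dN.
set r1 := rho (- d *: _ + d *: _); set r2 := rho (d *: _ + - d *: _).
set r3 := rho (d *: _ + d *: _); set r4 := rho (- d *: _ + - d *: _).
clear.
rewrite !ler_norml => /andP[? ?] /andP[? ?] /andP[? ?] /andP[? ?].
apply/andP; lra.
Unshelve. all: by end_near. Qed.

Lemma is_derive_row_mx m n (F : 'rV[R]_(m + n) -> R) a b j d :
  is_derive (row_mx a b) (ebase (rshift m j)) F d ->
  is_derive b (ebase j) (fun y => F (row_mx a y)) d.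
Proof.
have E : (fun h : R => h^-1 *: (F (h *: ebase (rshift m j) + row_mx a b)
             - F (row_mx a b))) =
         (fun h : R => h^-1 *: (F (row_mx a (h *: ebase j + b))
             - F (row_mx a b))).
  apply/funext => h; congr (_ *: (F _ - _)).
  rewrite /ebase delta_mx_rshift.
  by rewrite scale_row_mx add_row_mx scaler0 add0r.
move=> [D1 D2]; apply: DeriveDef.
  by move: D1; rewrite /derivable /= E.
by move: D2; rewrite /derive /= E.
Qed.

(** The minimum over the compact ball is not reached on the boundary, where f
    exceeds its value at the centre; at an interior minimum the partial
    derivatives vanish. *)
Lemma interior_critical_point n (f : 'rV[R]_n -> R)
    (df : 'rV[R]_n -> 'I_n -> R) r :
  0 < r -> (forall k, `|k| <= r -> {for k, continuous f}) ->
  (forall k j, `|k| <= r -> is_derive k (ebase j) f (df k j)) ->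
  (forall k, `|k| = r -> f 0 < f k) ->
  exists2 k, `|k| < r & forall j, df k j = 0.
Proof.
move=> r0 fC fD fS.
pose B := [set k : 'rV[R]_n | `|k| <= r].
have BE : B = closed_ball 0 r.
  rewrite closed_ballE//; apply/seteqP.
  by split => k; rewrite /B /closed_ball_ /= sub0r normrN.
have Bc : compact B.
  apply: bounded_closed_compact; last by rewrite BE; exact: closed_ball_closed.
  exists r; split; first exact: num_real.
  by move=> s rs k Bk; exact: le_trans Bk (ltW rs).
have B0 : B !=set0 by exists 0; rewrite /B /= normr0 ltW.
have fB : {within B, continuous f}.
  apply: continuous_in_subspaceT => k; rewrite inE; exact: fC.
have [k kB kmin] := EVT_min_rV B0 Bc fB.
move: kB; rewrite inE => kB.
have kr : `|k| < r.
  rewrite lt_neqAle; apply/andP; split; last exact: kB.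
  apply/eqP => /fS; rewrite ltNge kmin// inE /B /= normr0; exact: ltW.
exists k => // j.
pose s := r - `|k|; have s0 : 0 < s by rewrite subr_gt0.
have inB t : t \in `](-s), s[%R -> `|k + t *: ebase j| <= r.
  rewrite in_itv /= -ltr_norml => ts.
  rewrite (le_trans (ler_normD _ _))// normrZ.
  have := ler_wpM2l (normr_ge0 t) (ebase_norm n j).
  rewrite /s in ts; lra.
have lD t : t \in `](-s), s[%R ->
    is_derive t 1 (fun t : R => f (k + t *: ebase j)) (df (k + t *: ebase j) j).
  by move=> ts; apply: is_derive_line; apply: fD; exact: inB.
have o_in : 0 \in `](-s), s[%R by rewrite in_itv /= oppr_lt0 s0.
have := lD 0 o_in; rewrite scale0r addr0 => D0.
have D0' : is_derive (0:R) 1 (fun t : R => f (k + t *: ebase j)) 0.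
  apply: (@derive1_at_min R _ (-s) s) => //.
  - lra.
  - by move=> t /lD D; exact: (@ex_derive _ _ _ _ _ _ _ D).
  - by move=> t ts; rewrite scale0r addr0; apply: kmin; rewrite inE; exact: inB.
by rewrite -(@derive_val _ _ _ _ _ _ _ D0) (@derive_val _ _ _ _ _ _ _ D0').
Qed.

End Shortcut.

(** * The reduced function *)

Section Main.
Context {R : realType}.

Lemma continuous_at_rV n (f : 'rV[R]_n -> R) k :
  (forall e, 0 < e -> exists2 r, 0 < r &
     forall h, `|h| < r -> `|f (k + h) - f k| <= e) ->
  {for k, continuous f}.
Proof.
move=> H; apply/(@cvgrPdist_le _ _ _ (nbhs k)) => e /H[r r0 Hr].
apply/nbhs_ballP; exists r => // y; rewrite -ball_normE /= => yk.
by rewrite distrC -(subrKC k y); apply: Hr; rewrite distrC.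
Qed.

Lemma prod_domain_row_mx m n (O1 : set 'rV[R]_m) (O2 : set 'rV[R]_n) a b :
  prod_domain O1 O2 (row_mx a b) <-> O1 a /\ O2 b.
Proof. by rewrite /prod_domain /= row_mxKl row_mxKr. Qed.

Lemma open_prod_domain m n (O1 : set 'rV[R]_m) (O2 : set 'rV[R]_n) :
  open O1 -> open O2 -> open (prod_domain O1 O2).
Proof.
move=> o1 o2; apply: openI.
  apply: (@open_comp _ _ (@lsubmx R 1 m n)) => // x _.
  exact/differentiable_continuous/differentiable_lsubmx.
apply: (@open_comp _ _ (@rsubmx R 1 m n)) => // x _.
exact/differentiable_continuous/differentiable_rsubmx.
Qed.

Context {M N : nat} {O1 : set 'rV[R]_M} {O2 : set 'rV[R]_N}.
Context {F : 'rV[R]_(M + N) -> R} {qstar : 'rV[R]_M -> 'rV[R]_N}.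
Context (oO1 : open O1) (oO2 : open O2).
Context (hF : smooth_on (prod_domain O1 O2) F).
Context (hmin : forall p, O1 p -> minimizer O2 F p (qstar p)).
Context (hgrad : forall p q, O1 p -> O2 q ->
  (grad_q F p q = 0 <-> q = qstar p)).
Context {p : 'rV[R]_M} (hp : O1 p).

Let x := row_mx p (qstar p).
Let B := hessian F x.
Let g : 'cV[R]_(M + N) := \col_i partial i F x.

Context (hjac : drsubmx B \in unitmx).

Let q_in : O2 (qstar p). Proof. by have [] := hmin _ hp. Qed.
Let oU : open (prod_domain O1 O2). Proof. exact: open_prod_domain. Qed.
Let xU : prod_domain O1 O2 x. Proof. exact/prod_domain_row_mx. Qed.
Let BT : B^T = B. Proof. exact: hessian_sym oU hF xU. Qed.
Let AT : (drsubmx B)^T = drsubmx B. Proof. by rewrite trmx_drsub BT. Qed.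
Let Fx : second_order_at F x g B.
Proof. exact: smooth_second_order oU hF xU. Qed.

Let gq (h : 'rV[R]_M) (k : 'rV[R]_N) :
  (row_mx h k *m g) 0 0 = (h *m usubmx g) 0 0.
Proof.
have g0 : dsubmx g = 0.
  have /(hgrad _ _ hp q_in) G0 : qstar p = qstar p by [].
  apply/colP => j; rewrite !mxE.
  by move/rowP/(_ j): G0; rewrite !mxE.
by rewrite -[g]vsubmxK mul_row_col g0 mulmx0 addr0 col_mxKu.
Qed.

(** The expansion of F at x: there is no linear term in k, as the gradient in
    q vanishes at the minimizer. *)
Let Fx' e : 0 < e -> exists2 r, 0 < r &
  forall (h : 'rV[R]_M) (k : 'rV[R]_N) T, `|h| <= T -> `|k| <= T -> T < r ->
    `|F (row_mx (p + h) (qstar p + k)) - F x - (h *m usubmx g) 0 0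
      - 2^-1 * bform B (row_mx h k) (row_mx h k)| <= e * T ^+ 2.
Proof.
move=> e0; have [r r0 H] := Fx e e0; exists r => // h k T hT kT Tr.
have hkT := row_mx_norm_le _ _ _ _ _ hT kT.
rewrite -add_row_mx -(gq h k); apply: le_trans (H _ (le_lt_trans hkT Tr)) _.
rewrite ler_wpM2l ?(ltW e0)// ler_sqr ?nnegrE//.
exact: le_trans hT.
Qed.

(** Along a ray from the minimizer the first-order term vanishes, so a negative
    quadratic term would eventually make F smaller than its minimum. *)
Let hessian_qq_psd k : 0 <= bform (drsubmx B) k k.
Proof.
rewrite leNgt; apply/negP => neg.
pose a := bform (drsubmx B) k k.
(* If a < 0, this e makes the remainder less than half of the quadratic term. *)
pose e := - a / (4 * (`|k| ^+ 2 + 1)).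
have k1 : 0 < `|k| ^+ 2 + 1 by rewrite ltr_wpDl// exprn_ge0.
have e0 : 0 < e by rewrite divr_gt0 ?oppr_gt0// mulr_gt0.
have [r r0 H] := Fx' e e0.
have [r2 r20 H2] := open_ball_sub _ _ _ oO2 q_in.
pose t := Num.min r r2 / (`|k| + 1).
have k0 : 0 < `|k| + 1 by rewrite ltr_wpDl.
have m0 : 0 < Num.min r r2 by rewrite lt_min r0 r20.
have t0 : 0 < t by rewrite divr_gt0.
have : `|t *: k| < Num.min r r2.
  rewrite normrZ ger0_norm ?(ltW t0)// /t mulrAC ltr_pdivrMr// ltr_pM2l//.
  by rewrite ltrDl.
rewrite lt_min => /andP[tkr tkr2].
have := H 0 (t *: k) `|t *: k|.
rewrite normr0 normr_ge0 => /(_ isT (lexx _) tkr).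
have [_ /(_ _ (H2 _ tkr2))] := hmin _ hp.
rewrite -/x addr0 mul0mx [X in _ - X - _]mxE bform_row_mx// !bform0l.
rewrite bformZl bformZr normrZ (ger0_norm (ltW t0)) -/a exprMn.
set d := F _ => dx; rewrite ler_norml => /andP[_ Hd].
have : 0 <= t ^+ 2 * (2^-1 * a + e * `|k| ^+ 2) by lra.
rewrite pmulr_rge0 ?exprn_gt0//.
have -> : e * `|k| ^+ 2 = - a / 4 - e by rewrite /e; field; rewrite gt_eqF.
rewrite -/a in neg; lra.
Qed.

(** This replaces the implicit function theorem.  On the sphere of radius
    K |h| around qstar p, the coercivity of the qq block dominates the
    cross term and the remainder as soon as K is large, so F (p + h, .)
    exceeds there its value at the centre.  It thus has a critical point
    inside, which is qstar (p + h), the only critical point. *)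
Lemma minimizer_lipschitz : exists2 K, 0 < K &
  exists2 r, 0 < r & forall h, `|h| < r ->
    `|qstar (p + h) - qstar p| <= K * `|h|.
Proof.
have [c c0 Hc] := coercive_form _ _ AT hjac hessian_qq_psd.
have [C C0 HC] := bform_bounded _ _ (ursubmx B).
(* The cross term C |h| rho = (C / K) rho^2 is at most (c / 8) rho^2, and
   the two remainders add at most (c / 16) rho^2: together they stay below
   the quadratic term (c / 2) rho^2. *)
pose K := 1 + 8 * C / c.
have K1 : 1 <= K by rewrite lerDl divr_ge0 ?mulr_ge0// ltW.
have K0 : 0 < K by exact: lt_le_trans K1.
have e0 : 0 < c / 32 by rewrite divr_gt0.
have [r0 r00 H] := Fx' _ e0.
have [r1 r10 H1] := open_ball_sub _ _ _ oO1 hp.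
have [r2 r20 H2] := open_ball_sub _ _ _ oO2 q_in.
exists K => //; exists (Num.min r0 (Num.min r1 r2) / K).
  by rewrite divr_gt0// !lt_min r00 r10 r20.
move=> h; rewrite ltr_pdivlMr// mulrC !lt_min => /and3P[hr0 hr1 hr2].
have [->|h0] := eqVneq h 0; first by rewrite addr0 subrr !normr0 mulr0.
pose rho := K * `|h|.
have rho0 : 0 < rho by rewrite mulr_gt0// normr_gt0.
have h_rho : `|h| <= rho by rewrite ler_peMl.
have hO1 : O1 (p + h) by apply: H1; exact: le_lt_trans hr1.
have kO2 k : `|k| <= rho -> O2 (qstar p + k).
  by move=> kr; apply/H2/(le_lt_trans kr).
have kU k : `|k| <= rho ->
    prod_domain O1 O2 (row_mx (p + h) (qstar p + k)).
  by move=> /kO2 k2; apply/prod_domain_row_mx.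
pose f k := F (row_mx (p + h) (qstar p + k)).
have [k kr|k j kr|k kr|k kr kcrit] := @interior_critical_point R _ f
    (fun k j => partial (rshift M j) F (row_mx (p + h) (qstar p + k))) rho rho0.
- apply: continuous_at_rV => e ep.
  have [r rp Hr] := iter_partial_near _ _ _ [::] _ _ hF (kU k kr) ep.
  exists r => // y yr; have := Hr (row_mx 0 y).
  rewrite add_row_mx addr0 /f addrA; apply; apply: le_lt_trans yr.
  by apply: row_mx_norm_le => //; rewrite normr0.
- apply: (is_derive_translate _ (fun y => F (row_mx (p + h) y))).
  apply: is_derive_row_mx.
  exact: (smooth_is_derive _ _ _ [::] _ _ hF (kU k kr)).
- have := H h k rho h_rho; rewrite kr lexx => /(_ isT hr0).
  have := H h 0 rho h_rho; rewrite normr0 ltW// => /(_ isT hr0).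
  rewrite !bform_row_mx// !bform0r.
  have := Hc k; have := HC h k.
  rewrite /f kr.
  set F1 := F (row_mx (p + h) (qstar p + k)).
  set F0 := F (row_mx _ _).
  have -> : C * `|h| * rho = C / K * rho ^+ 2.
    by rewrite /rho; field; rewrite gt_eqF.
  have CK : C / K * rho ^+ 2 <= c / 8 * rho ^+ 2.
    rewrite ler_wpM2r ?exprn_ge0 ?(ltW rho0)// ler_pdivrMr//.
    have -> : c / 8 * K = c / 8 + C by rewrite /K; field; rewrite gt_eqF.
    by rewrite lerDr divr_ge0// ltW.
  rewrite !ler_norml => /andP[b1 _] b2 /andP[_ b3] /andP[b4 _].
  have : 0 < c * rho ^+ 2 by rewrite mulr_gt0// exprn_gt0.
  lra.
have <- : qstar p + k = qstar (p + h).
  apply/(hgrad _ _ hO1 (kO2 _ (ltW kr))).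
  by apply/rowP => j; rewrite !mxE.
by rewrite addrAC subrr add0r ltW.
Qed.

(** Upper bound: the minimum is at most the value at the test point
    qstar p + schur_min B h.  Lower bound: the value at qstar (p + h), after
    completing the square and dropping a nonnegative term.  Both points are at
    distance O(|h|) from (p, qstar p), so that both remainders are o(|h|^2). *)
Lemma reduced_second_order :
  second_order_at (reduced F qstar) p (usubmx g) (schur B).
Proof.
move=> e e0.
have [K K0 [rK rK0 HK]] := minimizer_lipschitz.
have [L L0 HL] := mulmx_bounded _ _ (- (ursubmx B *m invmx (drsubmx B))).
have HL' h : `|schur_min B h| <= L * `|h|.
  by rewrite /schur_min -mulmxA -mulmxN.
have K_ge0 := ltW K0; have L_ge0 := ltW L0.
(* Both test displacements (h, k) satisfy |h|, |k| <= T |h|. *)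
pose T := 1 + K + L.
have T0 : 0 < T by rewrite /T !addr_gt0.
have e'0 : 0 < e / T ^+ 2 by rewrite divr_gt0// exprn_gt0.
have [r0 r00 H] := Fx' _ e'0.
have [r1 r10 H1] := open_ball_sub _ _ _ oO1 hp.
have [r2 r20 H2] := open_ball_sub _ _ _ oO2 q_in.
exists (Num.min rK (Num.min r0 (Num.min r1 r2) / T)).
  by rewrite lt_min rK0 divr_gt0// !lt_min r00 r10 r20.
move=> h; rewrite lt_min => /andP[hrK].
rewrite ltr_pdivlMr// mulrC !lt_min => /and3P[hr0 hr1 hr2].
have hT : `|h| <= T * `|h| by rewrite ler_peMl// /T -addrA lerDl addr_ge0.
have TE : e / T ^+ 2 * (T * `|h|) ^+ 2 = e * `|h| ^+ 2.
  by field; rewrite gt_eqF.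
have hO1 : O1 (p + h) by apply: H1; exact: le_lt_trans hr1.
have LT : `|schur_min B h| <= T * `|h|.
  apply: le_trans (HL' h) _; rewrite ler_wpM2r// /T.
  by rewrite lerDr addr_ge0.
have KT : `|qstar (p + h) - qstar p| <= T * `|h|.
  apply: le_trans (HK h hrK) _; rewrite ler_wpM2r// /T.
  by rewrite addrAC lerDr addr_ge0.
have upper := H h _ _ hT LT hr0.
have lower := H h _ _ hT KT hr0.
move: upper lower; rewrite !complete_square// subrr bform0l addr0 TE.
rewrite [qstar p + (_ - _)]addrC subrK.
have [_ /(_ _ (H2 _ (le_lt_trans LT hr2)))] := hmin _ hO1.
have := hessian_qq_psd (qstar (p + h) - qstar p - schur_min B h).
rewrite /reduced -/x.
set F1 := F (row_mx (p + h) (qstar (p + h))).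
set F2 := F (row_mx (p + h) (qstar p + _)).
rewrite !ler_norml => b1 b2 /andP[_ b3] /andP[b4 _].
apply/andP; lra.
Qed.

End Main.

Theorem theorem5 (R : realType) (M N : nat) (hM : (1 <= M)%N) (hN : (1 <= N)%N)
  (O1 : set 'rV[R]_M) (O2 : set 'rV[R]_N)
  (F : 'rV[R]_(M + N) -> R) (qstar : 'rV[R]_M -> 'rV[R]_N)
  (hO1 : region O1) (hO2 : region O2)
  (hF : smooth_on (prod_domain O1 O2) F)
  (hmin : forall p, O1 p -> minimizer O2 F p (qstar p))
  (huniq : forall p q, O1 p -> minimizer O2 F p q -> q = qstar p)
  (hgrad : forall p q, O1 p -> O2 q -> (grad_q F p q = 0 <-> q = qstar p))
  (hjac : forall p, O1 p ->
     drsubmx (hessian F (row_mx p (qstar p))) \in unitmx)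
  (p : 'rV[R]_M) (hp : O1 p)
  (hH : hessian F (row_mx p (qstar p)) \in unitmx) :
  (\forall d \near 0^'+,
     shortcut_hessian (reduced F qstar) p d \in unitmx) /\
  forall m m' : 'I_M,
    (fun d : R => invmx (shortcut_hessian (reduced F qstar) p d) m m') @ 0^'+
      --> inv_hessian_pp F p (qstar p) m m'.
Proof.
have [oO1 _ _] := hO1; have [oO2 _ _] := hO2.
have q_in : O2 (qstar p) by have [] := hmin _ hp.
set B := hessian F (row_mx p (qstar p)) in hH *.
have BT : B^T = B.
  apply: hessian_sym (open_prod_domain _ _ _ _ oO1 oO2) hF _.
  exact/prod_domain_row_mx.
have [Su SE] := invmx_schur _ _ B (hjac _ hp) hH.
rewrite /inv_hessian_pp -/B SE.
apply: cvg_invmx_coord => // m m'.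
apply: shortcut_hessian_cvg; first exact: schur_sym.
exact: (reduced_second_order oO1 oO2 hF hmin hgrad hp (hjac _ hp)).
Qed.
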